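(* Let $K$ be a field and $c\ge 1$ an integer. Let $\mathbf{M}$ be a finitely generated (not necessarily graded) $\mathrm{OI}$-module over $(\mathbf{X}^{\mathrm{OI},1})^{\otimes c}$ or a finitely generated (not necessarily graded) $\mathrm{FI}$-module over $(\mathbf{X}^{\mathrm{FI},1})^{\otimes c}$. Then there are integers $A, B$ such that, for all sufficiently large $n$, \[ \dim \mathbf{M}_n = A n + B . \]
   Context: $\dim$ denotes Krull dimension of a $\mathbf{P}_n$-module. $\mathrm{OI}$ (resp. $\mathrm{FI}$) is the category with objects $[n] = \{1,\dots,n\}$, $n \ge 0$ ($[0]=\emptyset$), and morphisms the strictly increasing (resp. injective) maps $\varepsilon\colon [m]\to[n]$. The $\mathrm{OI}$-algebra $(\mathbf{X}^{\mathrm{OI},1})^{\otimes c}$ (resp. $\mathrm{FI}$-algebra $(\mathbf{X}^{\mathrm{FI},1})^{\otimes c}$) over $K$ is the functor $\mathbf{P}$ from $\mathrm{OI}$ (resp. $\mathrm{FI}$) to commutative $K$-algebras with $\mathbf{P}_n = K[x_{i,j} : 1\le i\le c,\ 1\le j\le n]$ (so $\mathbf{P}_0=K$) and, for $\varepsilon\colon[m]\to[n]$, $\varepsilon_*\colon \mathbf{P}_m\to\mathbf{P}_n$ the $K$-algebra homomorphism with $\varepsilon_*(x_{i,j}) = x_{i,\varepsilon(j)}$. An $\mathrm{OI}$-module (resp. $\mathrm{FI}$-module) $\mathbf{M}$ over $\mathbf{P}$ is a functor from $\mathrm{OI}$ (resp. $\mathrm{FI}$) to $K$-vector spaces such that each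 $\mathbf{M}_n = \mathbf{M}([n])$ is a $\mathbf{P}_n$-module and $\mathbf{M}(\varepsilon)(aq) = \varepsilon_*(a)\,\mathbf{M}(\varepsilon)(q)$ for all $\varepsilon\colon[m]\to[n]$, $a\in\mathbf{P}_m$, $q\in\mathbf{M}_m$. It is finitely generated if there is a finite subset of $\coprod_n \mathbf{M}_n$ not contained in any proper submodule (subfunctor compatible with the module structures). *)

(* Defs.v *)
From HB Require Import structures.
From mathcomp Require Import all_boot all_order all_algebra.
From mathcomp Require Import mpoly.
Set Implicit Arguments.
Unset Strict Implicit.
Unset Printing Implicit Defensive.
Import GRing.Theory.
Local Open Scope ring_scope.

(* The object [n] = {1, ..., n} is 'I_n, i.e. indices start at 0.  Morphisms
   are finite functions satisfying a boolean condition, so that equality of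
   morphisms is pointwise equality. *)
Variant OI_or_FI := OI | FI.

Definition is_mor (C : OI_or_FI) (m n : nat) (f : {ffun 'I_m -> 'I_n}) : bool :=
  match C with
  | OI => [forall i : 'I_m, forall j : 'I_m, (i < j)%N ==> (f i < f j)%N]
  | FI => injectiveb f
  end.

Definition mor (C : OI_or_FI) (m n : nat) :=
  {f : {ffun 'I_m -> 'I_n} | is_mor C f}.

Lemma is_mor_id C n : is_mor C [ffun i : 'I_n => i].
Proof.
case: C => /=.
  by apply/forallP => i; apply/forallP => j; rewrite !ffunE implybb.
by apply/injectiveP => i j; rewrite !ffunE.
Qed.

Lemma is_mor_comp C m n p (g : mor C n p) (f : mor C m n) :
  is_mor C [ffun i => val g (val f i)].
Proof.
case: C g f => -[g gP] [f fP] /=.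
  apply/forallP => i; apply/forallP => j; apply/implyP => ltij; rewrite !ffunE.
  move/forallP/(_ (f i))/forallP/(_ (f j))/implyP: gP; apply.
  by move/forallP/(_ i)/forallP/(_ j)/implyP: fP; apply.
apply/injectiveP => i j; rewrite !ffunE.
by move/(injectiveP _ gP)/(injectiveP _ fP).
Qed.

Definition mor_id C n : mor C n n := exist (@is_mor C n n) _ (is_mor_id C n).
Definition mor_comp C m n p (g : mor C n p) (f : mor C m n) : mor C m p :=
  exist (@is_mor C m p) _ (is_mor_comp g f).

Section Algebra.
Variables (K : fieldType) (c : nat).

Definition Pn (n : nat) : comNzRingType :=
  GRing.ComNzRing.clone {mpoly K[c * n]} _.

Definition xvar (n : nat) (i : 'I_c) (j : 'I_n) : Pn n :=
  'X_(mxvec_index i j) : {mpoly K[c * n]}.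

(* The K-algebra map Pn m -> Pn n induced by f: substitute xvar i (f j) for xvar i j. *)
Definition x_image C m n (f : mor C m n) : (c * m).-tuple (Pn n) :=
  [tuple mxvec (\matrix_(i < c, j < m) xvar i (val f j)) 0 k | k < c * m].

Definition Pmap C m n (f : mor C m n) : Pn m -> Pn n := comp_mpoly (x_image f).

HB.instance Definition _ C m n (f : mor C m n) :=
  GRing.RMorphism.copy (Pmap f) (comp_mpoly (x_image f)).

Lemma PmapX C m n (f : mor C m n) i j : Pmap f (xvar i j) = xvar i (val f j).
Proof. by rewrite /Pmap comp_mpolyXU -tnth_nth tnth_mktuple mxvecE mxE. Qed.

(* The K-space structure of M_n is the restriction of its P_n-module structure
   along K -> P_n.  The type of [act] says that M(f) is additive with
   M(f)(a *: q) = Pmap f a *: M(f) q; in particular M(f) is K-linear. *)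
Record Pmodule (C : OI_or_FI) := PModule {
  obj :> forall n, lmodType (Pn n);
  act : forall m n (f : mor C m n),
    {linear obj m -> obj n | (Pmap f : Pn m -> Pn n) \; *:%R};
  act_id : forall n (q : obj n), act (mor_id C n) q = q;
  act_comp : forall m n p (g : mor C n p) (f : mor C m n) (q : obj m),
    act (mor_comp g f) q = act g (act f q) }.

Definition submodule C (M : Pmodule C) (N : forall n, {pred M n}) : Prop :=
  (forall n, GRing.submod_closed (N n)) /\
  (forall m n (f : mor C m n) (q : M m), q \in N m -> act M f q \in N n).

Definition finitely_generated C (M : Pmodule C) : Prop :=
  exists G : seq {n : nat & M n},
    forall N : (forall n, {pred M n}), submodule N ->
      (forall g, g \in G -> tagged g \in N (tag g)) ->
      forall n (q : M n), q \in N n.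

End Algebra.

Section KrullDimension.
Variables (R : comNzRingType) (V : lmodType R).

Definition contains_ann (p : {pred R}) : Prop :=
  forall a : R, (forall v : V, a *: v = 0) -> a \in p.

(* p_0 < p_1 < ... < p_(k-1) are k primes of R containing Ann V *)
Definition prime_chain (k : nat) (p : 'I_k -> prime_idealr R) : Prop :=
  (forall i, contains_ann (p i)) /\
  (forall i j : 'I_k, (i < j)%N ->
     {subset p i <= p j} /\ exists2 a, a \in p j & a \notin p i).

(* dim V = d, where dim V = dim (R / Ann V): d + 1 is the largest number of
   primes in a chain.  The zero module has dimension -1. *)
Definition krull_dim_is (d : int) : Prop :=
  exists k : nat, [/\ d = k%:Z - 1,
    exists p : 'I_k -> prime_idealr R, prime_chain p
    & forall l (p : 'I_l -> prime_idealr R), prime_chain p -> (l <= k)%N].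

End KrullDimension.

(* Main.v *)
From HB Require Import structures.
Require Import Defs.
From mathcomp Require Import all_boot all_order all_algebra.
From mathcomp Require Import mpoly zify.
From mathcomp Require boolp classical_sets.
Set Implicit Arguments.
Unset Strict Implicit.
Unset Printing Implicit Defensive.
Import Order.TTheory GRing.Theory.
Local Open Scope ring_scope.

(** The dimension of a quotient of [K[x_1, ..., x_N]] by an ideal [I] is the
    largest size of a set [S] of variables with [I] meeting the subring
    [K[S]] only in [0] (the dimension being -1 if even the empty set fails).
    This turns the problem into one about finite sets.

    For [I] the annihilator of [M_n], and because [K[S]] is a domain, the
    condition on [S] holds exactly when it holds for the annihilator of the image
    of some generator [g] under some morphism [delta] into [[n]]: otherwise a
    finite product of nonzero elements of [K[S]] would kill [M_n]
    ([indep_ann_generator]).  Read such a triple [(g, delta, S)] as a word with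
    one letter per column [j] of the variables: the letter is marked if [j] is
    in the image of [delta], and its weight is the number of variables of [S] in
    that column.  The number of marks is bounded by the degrees of the
    generators, the weights are bounded by [c], and deleting an unmarked letter
    gives another word ([indep_delete_column]), since [delta] then factors
    through the injection of OI that skips [j], and that injection embeds the
    smaller polynomial ring in the larger one.

    These three properties already force the maximal weight [h n] of a word of
    length [n] to be eventually linear ([words_linear]).  Let [A] be the largest
    integer such that words have arbitrarily many unmarked letters of weight at
    least [A].  Keeping only such letters, and the marked ones, gives
    [h n >= A * n - const].  Conversely the number of unmarked letters of weight
    greater than [A] is bounded, so a long word has an unmarked letter of weight
    at most [A], whose deletion shows [h (n + 1) <= h n + A].  So [h n - A * n]
    is eventually nonincreasing and bounded below, hence eventually constant.
    The argument is the same for OI and FI.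

    The description of the dimension has two halves.

    Upper bound: if [p_0 < ... < p_m] are primes over [I] and [a_k] lies in
    [p_(k+1)] but not in [p_k], then the [a_k] are algebraically independent
    modulo [p_0] ([chain_alg_indep]).  If every set of [m] variables were
    dependent modulo [p_0], then each would contain the variables of some leading
    monomial of [p_0], so among the monomials of degree at most [b] only
    [O(b ^ (m - 1))] would fail to be leading monomials; these span the
    polynomials of degree at most [b] modulo [p_0], which leaves no room for
    [m] algebraically independent elements
    ([alg_dep_of_dependent_subsets]).

    Lower bound: if [S] is a maximal independent set modulo a prime [p] and [s]
    is in [S], there is a prime strictly above [p] modulo which [S] minus [s] is
    still independent ([indep_drop]).  Away from some nonzero [g] in [K[S]],
    every polynomial is integral over [K[S]] modulo [p], and the element
    [1 + x_s g], which is prime to [g] and has positive degree in [x_s], then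
    generates together with [p] an ideal that avoids the nonzero elements of
    [K[S]] free of [x_s]. *)

(** * Subrings generated by variables *)

Lemma mpoly_rmorph_ext (K : comNzRingType) (n : nat) (Q : comNzRingType)
    (f g : {rmorphism {mpoly K[n]} -> Q}) :
  (forall c, f c%:MP = g c%:MP) -> (forall i, f 'X_i = g 'X_i) -> f =1 g.
Proof.
move=> fgC fgX p; rewrite [p]mpolyE !rmorph_sum; apply: eq_bigr => m _.
rewrite -mul_mpolyC !rmorphM fgC; congr (_ * _).
by rewrite mpolyXE_id !rmorph_prod; apply: eq_bigr => i _; rewrite !rmorphXn fgX.
Qed.

Section Restriction.
Variables (K : fieldType) (N : nat).
Implicit Types (S T : {set 'I_N}) (i j : 'I_N).
Local Notation R := {mpoly K[N]}.

(** The subring [K[S]] is encoded as the image of the idempotent endomorphism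
    that kills the variables outside [S]; membership is then an equation, and
    stability under ring operations is the morphism property. *)
Definition restr S : R -> R :=
  comp_mpoly [tuple (if i \in S then 'X_i else 0) | i < N].

HB.instance Definition _ S := GRing.RMorphism.copy (restr S)
  (comp_mpoly [tuple (if i \in S then 'X_i else 0) | i < N]).

Lemma restrC S c : restr S c%:MP = c%:MP.
Proof. exact: comp_mpolyC. Qed.

Lemma restrX S i : restr S 'X_i = if i \in S then 'X_i else 0.
Proof. by rewrite /restr comp_mpolyXU -tnth_nth tnth_mktuple. Qed.

Lemma restrI S T a : restr S (restr T a) = restr (S :&: T) a.
Proof.
apply: (mpoly_rmorph_ext (f := restr S \o restr T)) => [c|i] /=.
  by rewrite !restrC.
rewrite !restrX inE; case: (i \in T); first by rewrite restrX andbT.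
by rewrite rmorph0 andbF.
Qed.

Lemma restr_sub S T a : S \subset T -> restr T (restr S a) = restr S a.
Proof. by move=> /setIidPr sST; rewrite restrI sST. Qed.

Lemma restr_id S a : restr S (restr S a) = restr S a.
Proof. exact: restr_sub. Qed.

Lemma restr_set0 a : restr set0 a = (a@_0%MM)%:MP.
Proof.
have /= := @mpoly_rmorph_ext _ _ _ (restr set0) (@mpolyC N K \o mcoeff 0%MM).
apply=> [c|i] /=; first by rewrite restrC mcoeffC eqxx mulr1.
by rewrite restrX inE mcoeffX mnm1_eq0.
Qed.

Lemma restr_setT a : restr setT a = a.
Proof.
apply: (mpoly_rmorph_ext (f := restr setT) (g := idfun)) => [c|i] /=.
  exact: restrC.
by rewrite restrX inE.
Qed.

(** A polynomial seen as a univariate polynomial in the variable [i]. *)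
Definition poly_in i : R -> {poly R} :=
  mmap (polyC \o @mpolyC N K) (fun j => if j == i then 'X else ('X_j)%:P).

HB.instance Definition _ i := GRing.RMorphism.copy (poly_in i)
  (mmap (polyC \o @mpolyC N K) (fun j => if j == i then 'X else ('X_j)%:P)).

Lemma poly_inC i c : poly_in i c%:MP = c%:MP%:P.
Proof. exact: mmapC. Qed.

Lemma poly_inX i j : poly_in i 'X_j = if j == i then 'X else ('X_j)%:P.
Proof. by rewrite /poly_in mmapX mmap1U. Qed.

Lemma poly_inK i f : (poly_in i f).['X_i] = f.
Proof.
have /= := @mpoly_rmorph_ext _ _ _ (horner_eval 'X_i \o poly_in i) idfun.
apply=> [c|j] /=; rewrite /horner_eval; first by rewrite poly_inC hornerC.
by rewrite poly_inX; case: eqP => [->|_]; rewrite (hornerX, hornerC).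
Qed.

Lemma poly_in_eq0 i f : (poly_in i f == 0) = (f == 0).
Proof.
apply/eqP/eqP => [f0|->]; last exact: rmorph0.
by rewrite -(poly_inK i f) f0 horner0.
Qed.

Lemma poly_in_restrU i S f :
  poly_in i (restr (i |: S) f) = map_poly (restr S) (poly_in i f).
Proof.
have /= := @mpoly_rmorph_ext _ _ _ (poly_in i \o restr (i |: S))
  (map_poly (restr S) \o poly_in i).
apply=> [c|j] /=; first by rewrite restrC poly_inC map_polyC /= restrC.
rewrite restrX poly_inX !inE; case: (j =P i) => [->|ji] /=.
  by rewrite poly_inX eqxx map_polyX.
rewrite map_polyC /= restrX; case: ifP => _; last by rewrite rmorph0.
by rewrite poly_inX; case: eqP ji.
Qed.

Lemma poly_in_restr i S f : i \notin S -> poly_in i (restr S f) = (restr S f)%:P.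
Proof.
move=> iS; have /= := @mpoly_rmorph_ext _ _ _ (poly_in i \o restr S)
  (polyC \o restr S).
apply=> [c|j] /=; first by rewrite restrC poly_inC.
rewrite restrX; case: ifP => jS; last by rewrite !rmorph0.
by rewrite poly_inX; case: eqP jS iS => // -> ->.
Qed.

(** [I] meets [K[S]] only in [0]. *)
Definition indep (I : R -> Prop) S :=
  forall a, I (restr S a) -> restr S a = 0.

Lemma indep_sub (I J : R -> Prop) S T :
  (forall a, I a -> J a) -> S \subset T -> indep J T -> indep I S.
Proof.
move=> IJ sST iT a /IJ; rewrite -(restr_sub a sST) => /iT.
by rewrite restr_sub.
Qed.

End Restriction.

(** * Chains of primes give algebraically independent elements *)

Lemma polyMXn_factor (D : idomainType) (F : {poly D}) :
  F != 0 -> exists e G, F = G * 'X^e /\ G`_0 != 0.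
Proof.
move=> F0; have [e [G [G0 ->]]] := multiplicity_XsubC F 0.
exists e, G; rewrite subr0; split=> //.
by move: G0; rewrite F0 /= /root horner_coef0.
Qed.

Lemma horner_mul_add_coef0 (Q : comNzRingType) (F : {poly Q}) x :
  exists r, F.[x] = r * x + F`_0.
Proof.
elim/poly_ind: F => [|q u _]; first by exists 0; rewrite horner0 coef0 mul0r addr0.
by exists q.[x]; rewrite hornerMXaddC coefD coefMX coefC add0r.
Qed.

Section ChainIndep.
Variables (K : fieldType) (N m : nat).
Variables (p : nat -> prime_idealr {mpoly K[N]}) (a : m.-tuple {mpoly K[N]}).
Hypothesis p_sub : forall k, (k < m)%N -> {subset p k <= p k.+1}.
Hypothesis a_in : forall k : 'I_m, tnth a k \in p k.+1.
Hypothesis a_notin : forall k : 'I_m, tnth a k \notin p k.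

(** Suppose [f] is a nonzero polynomial in the variables from [k] on, and
    [f(a)] is in [p k].  Dividing [f] by the largest power of the variable [k]
    keeps [f(a)] in [p k], as [a_k] is not in this prime; modulo [p k.+1], which
    contains [a_k], only the constant term in the variable [k] remains, a nonzero
    polynomial in the later variables.  After [m] steps a nonzero constant lies in
    [p m]. *)
Lemma chain_alg_indep (f : {mpoly K[m]}) : f \mPo a \in p 0%N -> f = 0.
Proof.
pose S k := [set i : 'I_m | (k <= i)%N].
suff key d k g : (k + d = m)%N -> restr (S k) g \mPo a \in p k ->
    restr (S k) g = 0.
  move=> fp; have Sf : restr (S 0%N) f = f.
    have -> : S 0%N = setT by apply/setP => i; rewrite !inE.
    exact: restr_setT.
  by rewrite -Sf; apply: (key m 0%N); rewrite ?Sf.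
elim: d k g => [|d IHd] k g.
  rewrite addn0 => km.
  have -> : restr (S k) g = (g@_0%MM)%:MP.
    have S0 : S k = set0.
      by apply/setP => i; rewrite !inE km leqNgt ltn_ord.
    by rewrite S0 restr_set0.
  case: (g@_0%MM =P 0) => [->|/eqP c0]; first by rewrite mpolyC0.
  rewrite comp_mpolyC => /(idealMr (g@_0%MM)^-1%:MP).
  by rewrite -mpolyCM mulVf // mpolyC1 idealr1.
move=> kd; have km : (k < m)%N by rewrite -kd -addSnnS leq_addr.
pose i := Ordinal km.
have Sk : S k = i |: S k.+1.
  by apply/setP => j; rewrite !inE leq_eqVlt eq_sym.
move=> fp; apply/eqP; apply: contraTT fp => f0.
have [e [G [FG G0]]] : exists e G,
    poly_in i (restr (S k) g) = G * 'X^e /\ G`_0 != 0.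
  by apply: polyMXn_factor; rewrite poly_in_eq0.
have evf : restr (S k) g \mPo a =
    (map_poly (comp_mpoly a) G).[tnth a i] * tnth a i ^+ e.
  have ai : tnth a i = comp_mpoly a 'X_i by rewrite comp_mpolyXU -tnth_nth.
  rewrite ai horner_map /= -rmorphXn -rmorphM /=; congr (_ \mPo _).
  by rewrite -[LHS](poly_inK i) FG hornerM hornerXn.
apply/negP; rewrite evf prime_idealrM; case/orP; last first.
  elim: e {FG evf} => [|e IHe]; first by rewrite expr0 idealr1.
  by rewrite exprS prime_idealrM => /orP[|//]; apply/negP/a_notin.
move=> /(p_sub km) Gp.
suff /(IHd k.+1): restr (S k.+1) (poly_in i g)`_e \mPo a \in p k.+1.
  rewrite addSnnS => /(_ kd); move: FG; rewrite Sk poly_in_restrU => FG.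
  rewrite -(coef_map (restr (S k.+1))) FG coefMXn ltnn subnn.
  by apply/eqP.
have -> : restr (S k.+1) (poly_in i g)`_e = G`_0.
  by rewrite -(coef_map (restr (S k.+1))) -poly_in_restrU -Sk FG coefMXn ltnn subnn.
have [r Gr] := horner_mul_add_coef0 (map_poly (comp_mpoly a) G) (tnth a i).
rewrite -[_ \mPo _](coef_map (comp_mpoly a)) -(addKr (r * tnth a i) _`_0) addrC.
by rewrite -Gr rpredB // idealMr // a_in.
Qed.
End ChainIndep.

(** * Algebraically independent elements and independent variables *)

Lemma msupp_restr (K : fieldType) N (S : {set 'I_N}) (a : {mpoly K[N]}) u i :
  u \in msupp (restr S a) -> i \notin S -> u i = 0%N.
Proof.
move=> uS iS; apply/eqP; apply: contraTT uS => ui.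
rewrite mcoeff_msupp negbK {1}[a]mpolyE rmorph_sum raddf_sum big1 // => v _.
rewrite /= /restr comp_mpolyZ mcoeffZ comp_mpolyX.
case: (boolP [exists j, (j \notin S) && (v j != 0%N)]) => [/existsP|/existsPn] vS.
  have [j /andP[jS vj]] := vS; rewrite (bigD1 j) //= tnth_mktuple (negPf jS).
  by rewrite expr0n (negPf vj) mul0r mcoeff0 mulr0.
rewrite (eq_bigr (fun j => 'X_j ^+ v j)) => [|j _].
  rewrite -mpolyXE_id mcoeffX; case: (v =P u) => [vu|_]; last by rewrite mulr0.
  by have := vS i; rewrite iS vu ui.
rewrite tnth_mktuple; case: ifP => // jS.
by have := vS j; rewrite jS /= negbK => /eqP ->; rewrite !expr0.
Qed.

(** Exponent vectors with entries below [b] form a finite type, unlike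
    multinomials. *)
Definition mon n b (e : {ffun 'I_n -> 'I_b}) : 'X_{1..n} :=
  [multinom (e i : nat) | i < n].

Lemma mon_inj n b : injective (@mon n b).
Proof.
by move=> e e' /mnmP ee'; apply/ffunP => i; apply: val_inj; have := ee' i; rewrite !mnmE.
Qed.

Lemma mon_surj n b (u : 'X_{1..n}) : (mdeg u < b)%N ->
  exists e : {ffun 'I_n -> 'I_b}, mon e = u.
Proof.
move=> ub; have ui i : (u i < b)%N.
  by apply: leq_ltn_trans ub; rewrite mdegE (bigD1 i) //= leq_addr.
by exists [ffun i => Ordinal (ui i)]; apply/mnmP => i; rewrite mnmE ffunE.
Qed.

Lemma msizeM_le (K : fieldType) n (f g : {mpoly K[n]}) i j :
  (msize f <= i.+1)%N -> (msize g <= j.+1)%N -> (msize (f * g) <= (i + j).+1)%N.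
Proof.
have [->|f0] := eqVneq f 0; first by rewrite mul0r msize0.
have [->|g0] := eqVneq g 0; first by rewrite mulr0 msize0.
rewrite msizeM //; move: (msize f) (msize g) => s t; lia.
Qed.

Lemma msize_mon_comp (K : fieldType) N m T e (a : m.-tuple {mpoly K[N]})
    (x : {ffun 'I_m -> 'I_T}) :
  (forall i, msize (tnth a i) <= e.+1)%N ->
  (msize ('X_[mon x] \mPo a) <= (m * (T * e)).+1)%N.
Proof.
move=> ae; rewrite comp_mpolyX.
have powe p k : (msize p <= e.+1)%N -> (msize (p ^+ k : {mpoly K[N]}) <= (k * e).+1)%N.
  move=> pe; elim: k => [|k IHk]; first by rewrite expr0 msizeC oner_eq0.
  by rewrite exprS mulSn msizeM_le.
rewrite -[m in (m * _).+1]card_ord -sum_nat_const.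
elim/big_ind2: _ => [|p i q j|i _]; first by rewrite msizeC oner_eq0.
  exact: msizeM_le.
apply: leq_trans (powe _ _ (ae i)) _.
by rewrite ltnS leq_mul2r mnmE ltnW ?orbT.
Qed.

Section Counting.
Variables (K : fieldType) (N : nat).
Local Notation R := {mpoly K[N]}.
Variable I : R -> Prop.
Hypothesis I0 : I 0.
Hypothesis I_lin : forall a u v, I u -> I v -> I (a * u + v).

Lemma ideal_mul a u : I u -> I (a * u).
Proof. by move=> Iu; rewrite -[_ * _]addr0; apply: I_lin. Qed.

(** Vectors that are congruent modulo [I] to combinations of fewer other vectors
    satisfy a nontrivial linear relation modulo [I], since a matrix with more rows
    than columns has a nonzero row kernel. *)
Lemma linear_pigeonhole (X Y : finType) (B : {set Y}) (F : X -> R) (G : Y -> R) :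
    (forall x, exists c : Y -> K, I (F x - \sum_(y in B) c y *: G y)) ->
    (#|B| < #|X|)%N ->
  exists u : X -> K, (exists x, u x != 0) /\ I (\sum_x u x *: F x).
Proof.
move=> /boolp.choice[c cP] ltBX.
pose A := \matrix_(i < #|X|, j < #|B|) c (enum_val i) (enum_val j).
have A0 : kermx A != 0.
  by rewrite kermx_eq0 /row_free neq_ltn (leq_ltn_trans (rank_leq_col _) ltBX).
pose v := nz_row (kermx A).
have v0 : v != 0 by rewrite nz_row_eq0.
have vA : v *m A = 0 by apply/sub_kermxP; apply: nz_row_sub.
pose u x := v 0 (enum_rank x).
exists u; split.
  have [j vj] := rV0Pn _ v0.
  by exists (enum_val j); rewrite /u enum_valK.
have -> : \sum_x u x *: F x = \sum_x (u x)%:MP * (F x - \sum_(y in B) c x y *: G y).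
  rewrite -[LHS]subr0; under [RHS]eq_bigr do rewrite mulrBr.
  rewrite sumrB; congr (_ - _).
    by apply: eq_bigr => x _; rewrite mul_mpolyC.
  apply/esym; under eq_bigr do rewrite big_distrr /=.
  rewrite exchange_big big1 //= => y yB.
  under eq_bigr do rewrite mul_mpolyC scalerA.
  rewrite -scaler_suml; suff -> : \sum_x u x * c x y = 0 by rewrite scale0r.
  have vAy := congr1 (fun M : 'rV_ _ => M 0 (enum_rank_in yB y)) vA.
  rewrite !mxE in vAy; rewrite -[RHS]vAy.
  rewrite (reindex_onto enum_val enum_rank) /=; last first.
    by move=> x _; rewrite enum_rankK.
  apply: eq_big => [i|i _]; first by rewrite enum_valK eqxx.
  by rewrite mxE enum_rankK_in // /u enum_valK.
elim/big_rec: _ => // x y _; apply: I_lin; exact: cP.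
Qed.

Definition standard (u : 'X_{1..N}) := forall h, I h -> h != 0 -> mlead h <> u.

(** The leading term of [f] is removed by subtracting a multiple either of the
    monomial itself, if it is standard, or of an element of [I] with the same
    leading monomial.  The monomial order compares total degrees first, so
    degrees do not grow. *)
Lemma standard_span b (B : {set {ffun 'I_N -> 'I_b}}) (f : R) :
    (forall e, standard (mon e) -> e \in B) -> (msize f <= b)%N ->
  exists c, I (f - \sum_(e in B) c e *: 'X_[mon e]).
Proof.
move=> Bstd; elim/mleadrect: f => f IHf fb.
have [->|f0] := eqVneq f 0.
  by exists (fun=> 0); rewrite big1 ?subr0 // => e _; rewrite scale0r.
have [e fe] : exists e : {ffun 'I_N -> 'I_b}, mon e = mlead f.
  by apply: mon_surj; rewrite mlead_deg.
have cancel g : g != 0 -> mlead g = mlead f ->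
    exists a, let r := f - a *: g in (msize r <= b)%N /\ (r = 0 \/ (mlead r < mlead f)%O).
  move=> g0 gf; exists (mleadc f / mleadc g) => r.
  have a0 : mleadc f / mleadc g != 0.
    by rewrite mulf_neq0 ?invr_eq0 // mleadc_eq0.
  have rlead : (mlead r <= mlead f)%O.
    apply: le_trans (mleadB_le _ _) _.
    by rewrite mleadZ // gf joinxx.
  split.
    have [->|r0] := eqVneq r 0; first by rewrite msize0.
    by rewrite -mlead_deg // (leq_trans _ fb) // -mlead_deg // ltnS lemc_mdeg.
  have [|r0] := eqVneq r 0; [by left | right].
  rewrite lt_neqAle rlead andbT.
  apply: contraNneq r0 => rf; rewrite -mleadc_eq0 rf mcoeffB mcoeffZ -gf.
  by rewrite divfK ?subrr // mleadc_eq0.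
have span_r g : g != 0 -> mlead g = mlead f ->
    (exists c, I (g - \sum_(e in B) c e *: 'X_[mon e])) ->
    exists c, I (f - \sum_(e in B) c e *: 'X_[mon e]).
  move=> g0 gf [c Ic]; have [a] := cancel g g0 gf; set r := f - _ => -[rb rf].
  have [c' Ic'] : exists c, I (r - \sum_(e in B) c e *: 'X_[mon e]).
    case: rf => [->|rf]; last exact: IHf.
    by exists (fun=> 0); rewrite big1 ?subr0 // => e' _; rewrite scale0r.
  exists (fun e => a * c e + c' e).
  have -> : f - \sum_(e in B) (a * c e + c' e) *: 'X_[mon e] =
      a%:MP * (g - \sum_(e in B) c e *: 'X_[mon e]) +
      (r - \sum_(e in B) c' e *: 'X_[mon e]).
    under eq_bigr do rewrite scalerDl -scalerA.
    rewrite big_split /= -scaler_sumr mul_mpolyC scalerBr /r.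
    by rewrite [RHS]addrC addrACA subrK opprD; congr (_ + _); apply: addrC.
  exact: I_lin.
have [eB|/negP eB] := boolP (e \in B).
  apply: (span_r 'X_[mon e]); first by rewrite -msupp_eq0 msuppX.
    by rewrite mleadXm.
  exists (fun x => (x == e)%:R); rewrite (bigD1 e) //= eqxx scale1r big1 ?addr0 ?subrr //.
  by move=> x /andP[_ /negPf ->]; rewrite scale0r.
have /boolp.existsNP[h /boolp.not_implyP[Ih /boolp.not_implyP[h0 /boolp.contrapT hf]]] :
  ~ standard (mon e) by move=> /Bstd.
apply: (span_r h) => //; first by rewrite hf.
by exists (fun=> 0); rewrite big1 ?subr0 // => e' _; rewrite scale0r.
Qed.


(** Once the set of large exponents is chosen, the other exponents take at most
    [E] values each. *)
Lemma card_few_large b E m (B : {set {ffun 'I_N -> 'I_b}}) :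
    (0 < E)%N -> (0 < b)%N ->
    (forall e : {ffun 'I_N -> 'I_b}, e \in B -> (#|[set i | (E <= e i)%N]| <= m)%N) ->
  (#|B| <= 2 ^ N * (E ^ N * b ^ m))%N.
Proof.
move=> E0 b0 Bm.
pose fam (T : {set 'I_N}) (i : 'I_N) := [pred x : 'I_b | (i \in T) || (x < E)%N].
have cardE_lt : (#|[pred x : 'I_b | (x < E)%N]| <= E)%N.
  rewrite cardE -(size_map val) -[E in (_ <= E)%N](size_iota 0).
  apply: uniq_leq_size; first by rewrite map_inj_uniq ?enum_uniq //; apply: val_inj.
  by move=> y /mapP[x]; rewrite mem_enum inE => xE ->; rewrite mem_iota.
have famle (T : {set 'I_N}) : (#|T| <= m)%N -> (#|family (fam T)| <= E ^ N * b ^ m)%N.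
  move=> Tm; rewrite card_family foldrE big_map big_enum /=.
  apply: (@leq_trans (\prod_i (E * (if i \in T then b else 1)))%N).
    apply: leq_prod => i _; rewrite /fam; case: ifP => _ /=.
      apply: leq_trans (max_card _) _; rewrite card_ord leq_pmull //.
    by rewrite muln1.
  rewrite big_split prod_nat_const card_ord leq_mul2l -big_mkcond /=.
  rewrite prod_nat_const; apply/orP; right.
  by rewrite leq_pexp2l.
have Bsub : B \subset \bigcup_(T : {set 'I_N} | (#|T| <= m)%N) [set e in family (fam T)].
  apply/subsetP => e eB; apply/bigcupP; exists [set i | (E <= e i)%N]; first exact: Bm.
  by rewrite inE; apply/familyP => i; rewrite !inE; case: leqP.
apply: leq_trans (subset_leq_card Bsub) _.
have bound (P : pred {set 'I_N}) (G : {set 'I_N} -> {set {ffun 'I_N -> 'I_b}}) :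
   (#|\bigcup_(T | P T) G T| <= \sum_(T | P T) #|G T|)%N.
  elim/big_rec2: _ => [|T s A _ As]; first by rewrite cards0.
  by apply: leq_trans (leq_card_setU _ _) _; rewrite leq_add2l.
apply: leq_trans (bound _ _) _.
apply: (@leq_trans (\sum_(T : {set 'I_N}) (E ^ N * b ^ m))%N).
  rewrite big_mkcond /=; apply: leq_sum => T _; case: ifP => // Tm.
  by rewrite cardsE famle.
by rewrite sum_nat_const -cardsT -powersetT card_powerset cardsT card_ord.
Qed.

(** A dependent set [S] contributes a leading monomial in the variables of [S]
    only; a monomial whose exponents on [S] are all at least its degree is a
    multiple of it, hence not standard.  The integer [E] bounds these degrees
    for all [S] at once. *)
Lemma dependent_subsets_bound m :
    (forall S : {set 'I_N}, #|S| = m -> ~ indep I S) ->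
  exists E, (0 < E)%N /\ forall u, standard u -> (#|[set i | (E <= u i)%N]| < m)%N.
Proof.
move=> dep.
have /boolp.choice[h hP] : forall S : {set 'I_N}, exists h : R,
    #|S| = m -> [/\ I h, h != 0 & forall i, i \notin S -> mlead h i = 0%N].
  move=> S; have [Sm|Sm] := boolp.pselect (#|S| = m); last by exists 0.
  have /boolp.existsNP[a /boolp.not_implyP[Ia /eqP a0]] := dep S Sm.
  exists (restr S a) => _; split=> // i; apply: msupp_restr.
  exact: mlead_supp a0.
pose E := (\max_S mdeg (mlead (h S))).+1.
exists E; split=> // u std_u; rewrite ltnNge; apply/negP => /card_geqP[s [s_uniq sm sE]].
have Sm : #|[set i in s]| = m by rewrite cardsE (card_uniqP _).
have [Ih h0 hsupp] := hP _ Sm; set g := h _ in Ih h0 hsupp.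
have gu : (mlead g <= u)%MM.
  apply/mnm_lepP => i; case: (boolP (i \in s)) => [/sE|si]; last first.
    by rewrite hsupp // inE.
  rewrite inE => /(leq_trans _); apply; rewrite ltnW // ltnS.
  apply: (@leq_trans (mdeg (mlead g))); first by rewrite mdegE (bigD1 i) //= leq_addr.
  exact: (leq_bigmax (F := fun S => mdeg (mlead (h S)))).
apply: (std_u ('X_[u - mlead g] * g)).
- exact: ideal_mul.
- by rewrite mulf_neq0 // -msupp_eq0 msuppX.
by rewrite mleadM ?mleadXm ?submK // -msupp_eq0 msuppX.
Qed.

(** The products of powers of the [a_i] with exponents below [T] are [T ^ m] in
    number and have degree linear in [T], so that they lie, modulo [I], in a space
    of dimension at most a constant times [T ^ (m - 1)].  For large [T] they are
    linearly dependent. *)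
Lemma alg_dep_of_dependent_subsets m (a : m.-tuple R) :
    (forall S : {set 'I_N}, #|S| = m -> ~ indep I S) ->
  exists f : {mpoly K[m]}, f != 0 /\ I (f \mPo a).
Proof.
case: m a => [|m] a dep.
  have /boolp.existsNP[g /boolp.not_implyP[Ig /eqP g0]] := dep set0 (cards0 _).
  exists 1; split; first exact: oner_neq0.
  move: Ig g0; rewrite rmorph1.
  rewrite restr_set0 mpolyC_eq0 => /(ideal_mul (g@_0%MM)^-1%:MP) + c0.
  by rewrite -mpolyCM mulVf // mpolyC1.
have [E [E0 Estd]] := dependent_subsets_bound dep.
pose d := \max_(i < m.+1) msize (tnth a i).
have ad i : (msize (tnth a i) <= d.+1)%N.
  by apply/leqW; apply: (leq_bigmax (F := fun i => msize (tnth a i))).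
(* With D = (m.+1 * d).+1, b is at most T * D, so that the standard
   monomials considered are at most 2 ^ N * E ^ N * D ^ m * T ^ m in number. *)
pose T := (2 ^ N * (E ^ N * (m.+1 * d).+1 ^ m)).+1.
pose b := (m.+1 * (T * d)).+1.
pose B := [set e : {ffun 'I_N -> 'I_b} | boolp.asbool (standard (mon e))].
have Bstd (e : {ffun 'I_N -> 'I_b}) : standard (mon e) -> e \in B.
  by move=> std_e; rewrite inE; apply/boolp.asboolP.
have BT : (#|B| < #|{ffun 'I_m.+1 -> 'I_T}|)%N.
  apply: (@leq_ltn_trans (2 ^ N * (E ^ N * b ^ m))%N).
    apply: card_few_large => // e; rewrite inE => /boolp.asboolP/Estd.
    by rewrite ltnS; under eq_finset do rewrite mnmE.
  rewrite card_ffun !card_ord expnS.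
  apply: (@leq_ltn_trans (2 ^ N * (E ^ N * ((m.+1 * d).+1 ^ m * T ^ m)))%N).
    have bT : (b <= (m.+1 * d).+1 * T)%N.
      by rewrite /b [in X in (_ <= X)%N]mulSn -mulnA [(d * T)%N]mulnC -add1n leq_add2r.
    have pow_le x y : (x <= y -> x ^ m <= y ^ m)%N.
      by move=> xy; case: (m) => // k; rewrite leq_exp2r.
    by rewrite -expnMn !leq_pmul2l ?expn_gt0 ?E0 // pow_le.
  by rewrite !mulnA -(mulnA (2 ^ N)%N) ltn_pmul2r ?expn_gt0 //.
have [u [[x ux] Iu]] := linear_pigeonhole
  (F := fun x : {ffun 'I_m.+1 -> 'I_T} => 'X_[mon x] \mPo a)
  (G := fun e : {ffun 'I_N -> 'I_b} => 'X_[mon e])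
  (fun x => standard_span Bstd (msize_mon_comp x ad)) BT.
exists (\sum_x u x *: 'X_[mon x]); split.
  apply: contraNneq ux => f0; have := congr1 (mcoeff (mon x)) f0.
  rewrite mcoeff0 raddf_sum (bigD1 x) //= mcoeffZ mcoeffX eqxx mulr1 big1 ?addr0.
    by move/eqP.
  by move=> y yx; rewrite mcoeffZ mcoeffX (inj_eq (@mon_inj _ _)) (negPf yx) mulr0.
rewrite raddf_sum /=; congr I: Iu; apply: eq_bigr => y _.
by rewrite comp_mpolyZ.
Qed.

End Counting.

(** * Primes above a prime with an independent set of variables *)

(** An ideal that is maximal among those containing [J] and avoiding the
    multiplicative set [T] is prime. *)
Lemma prime_avoiding (Q : comNzRingType) (J T : Q -> Prop) :
    J 0 -> (forall a u v, J u -> J v -> J (a * u + v)) ->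
    T 1 -> (forall u v, T u -> T v -> T (u * v)) ->
    (forall u, J u -> ~ T u) ->
  exists q : prime_idealr Q, (forall u, J u -> u \in q) /\ forall u, u \in q -> ~ T u.
Proof.
move=> J0 J_lin T1 T_mul JT.
pose lin (A : Q -> Prop) := forall a u v, A u -> A v -> A (a * u + v).
(* The empty set is admitted so that the union of an empty chain qualifies. *)
pose P (A : Q -> Prop) := [/\ lin A, forall u, A u -> ~ T u &
  (exists u, A u) -> forall u, J u -> A u].
have [|A [[A_lin AT AJ] Amax]] := @classical_sets.Zorn_bigcup Q P.
  move=> F FP Ftot; split=> [a u v [X FX Xu] [Y FY Yv]|u [X /FP[_ XT _]]|].
  - have [XY|YX] := Ftot _ _ FX FY.
      by exists Y => //; have [+ _ _] := FP _ FY; apply=> //; apply: XY.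
    by exists X => //; have [+ _ _] := FP _ FX; apply=> //; apply: YX.
  - exact: XT.
  by move=> [v [X FX Xv]] u Ju; exists X => //; have [_ _] := FP _ FX; apply=> //; exists v.
have {}AJ : forall u, J u -> A u.
  move=> u Ju; apply: (AJ _ u Ju); apply: boolp.contrapT => A0.
  apply: (Amax J); last by split.
  by split=> [v Av|/(_ u Ju) Au]; case: A0; [exists v | exists u].
have A0 : A 0 by apply: AJ.
have A_mul a u : A u -> A (a * u) by move=> Au; rewrite -[_ * _]addr0; apply: A_lin.
have A_prime u v : A (u * v) -> A u \/ A v.
  move=> Auv; have meet w : ~ A w -> exists r b, A b /\ T (r * w + b).
    move=> Aw; apply: boolp.contrapT => noT.
    apply: (Amax (fun x => exists r b, A b /\ x = r * w + b)).
      split=> [x Ax|/(_ w) sub]; first by exists 0, x; rewrite mul0r add0r.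
      by apply/Aw/sub; exists 1, 0; rewrite mul1r addr0.
    split=> [a _ _ [r [b [Ab ->]]] [r' [b' [Ab' ->]]]|_ [r [b [Ab ->]]] Tx|_ x Jx].
    - exists (a * r + r'), (a * b + b'); split; first exact: A_lin.
      by rewrite mulrDr mulrDl addrACA !mulrA.
    - by apply: noT; exists r, b.
    by exists 0, x; rewrite mul0r add0r; split=> //; apply: AJ.
  case: (boolp.pselect (A u)) => [|/meet[r [b [Ab Tu]]]]; first by left.
  case: (boolp.pselect (A v)) => [|/meet[r' [b' [Ab' Tv]]]]; first by right.
  case: (AT _ _ (T_mul _ _ Tu Tv)).
  rewrite mulrDl mulrDr -addrA.
  have -> : r * u * (r' * v) = r * r' * (u * v) by rewrite mulrACA.
  apply: (A_lin) => //; apply: A_lin => //.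
  by rewrite mulrC; apply: A_mul.
pose q : pred Q := fun x => boolp.asbool (A x).
have q_ideal : idealr_closed q.
  split; first exact/boolp.asboolP.
    by apply/negP => /boolp.asboolP/AT.
  by move=> a u v /boolp.asboolP Au /boolp.asboolP Av; apply/boolp.asboolP/A_lin.
have q_prime : prime_idealr_closed q.
  move=> u v /boolp.asboolP/A_prime[] A'; apply/orP; [left|right]; exact/boolp.asboolP.
pose qP : prime_idealr Q := HB.pack q (isIdealr.Build Q q q_ideal)
  (isPrimeIdealrClosed.Build Q q q_prime).
exists qP; split=> u; first by move=> /AJ Au; apply/boolp.asboolP.
by move=> /boolp.asboolP/AT.
Qed.

(** Multiplying a relation of degree [k + 1] for [x] by the [k]-th power of its
    leading coefficient makes it monic in the scaled unknown.  The coefficients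
    stay in the subring where those of [F] live, here the fixed points of
    [sigma]. *)
Lemma scaled_monic (Q : comNzRingType) (sigma : {rmorphism Q -> Q}) (F : {poly Q}) k x :
    size F = k.+2 -> map_poly sigma F = F ->
  exists G, [/\ G \is monic, map_poly sigma G = G &
    G.[lead_coef F * x] = lead_coef F ^+ k * F.[x]].
Proof.
move=> Fk sF; set c := lead_coef F.
have sFi i : sigma F`_i = F`_i by rewrite -coef_map sF.
have cE : c = F`_k.+1 by rewrite /c lead_coefE Fk.
pose tl : {poly Q} := \poly_(j < k.+1) (F`_j * c ^+ (k - j)).
pose G : {poly Q} := 'X^(k.+1) + tl.
have szG : (size tl < size ('X^(k.+1) : {poly Q}))%N.
  by rewrite size_polyXn ltnS size_poly.
exists G; split.
- by rewrite monicE lead_coefDl // lead_coefXn.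
- rewrite rmorphD /= map_polyXn; congr (_ + _); apply/polyP => j.
  rewrite coef_map /= coef_poly; case: ifP => _ /=; last exact: rmorph0.
  by rewrite rmorphM rmorphXn /= cE !sFi.
rewrite hornerD hornerXn horner_poly (horner_coef F) Fk [in RHS]big_ord_recr /= -cE.
rewrite mulrDr addrC; congr (_ + _); last by rewrite exprMn mulrA -exprSr.
rewrite big_distrr; apply: eq_bigr => j _ /=.
have -> : c ^+ k = c ^+ (k - j) * c ^+ j by rewrite -exprD subnK // -ltnS.
by rewrite exprMn !mulrA; congr (_ * _); rewrite [RHS]mulrC mulrA.
Qed.

Lemma mpoly_ring_ind (K : comNzRingType) n (P : {mpoly K[n]} -> Prop) :
    (forall c, P c%:MP) -> (forall i, P 'X_i) ->
    (forall a b, P a -> P b -> P (a + b)) -> (forall a b, P a -> P b -> P (a * b)) ->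
  forall a, P a.
Proof.
move=> PC PX PD PM a; rewrite [a]mpolyE.
elim/big_rec: _ => [|u x _ Px]; first exact: PC.
apply: (PD) => //; rewrite -mul_mpolyC; apply: (PM); first exact: PC.
rewrite mpolyXE_id; elim/big_rec: _ => [|i y _ Py]; first exact: (PC 1).
apply: (PM) => //; elim: (u i) => [|k IHk]; first exact: (PC 1).
by rewrite exprS; apply: (PM).
Qed.

Lemma size_mul_gt1 (D : idomainType) (F G : {poly D}) :
  (1 < size F)%N -> G != 0 -> (1 < size (F * G)%R)%N.
Proof.
move=> F1 G0; have F0 : F != 0 by rewrite -size_poly_gt0 ltnW.
rewrite size_mul //; move: G0 F1; rewrite -size_poly_gt0.
by move: (size F) (size G) => x z; lia.
Qed.

(** An ideal enters the arguments about integrality only through a ring morphism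
    of which it is the kernel. *)
Lemma ideal_is_kernel (R : comNzRingType) (p : idealr R) :
  exists (Q : comNzRingType) (pi : {rmorphism R -> Q}),
    forall a, (pi a == 0) = (a \in p).
Proof.
exists {ideal_quot p}, \pi_{ideal_quot p}%qT => a.
by rewrite -(rmorph0 \pi_{ideal_quot p}%qT) -Quotient.idealrBE subr0.
Qed.

Section Integral.
Variables (K : fieldType) (N : nat) (Q : comNzRingType).
Local Notation R := {mpoly K[N]}.
Variable pi : {rmorphism R -> Q}.
Let ker a := pi a = 0.
Variable S : {set 'I_N}.
Hypothesis pS : indep ker S.

Local Notation integral := (integralOver (pi \o restr S)).

Lemma integral_restr a : integral (pi (restr S a)).
Proof. exact: (integral_id (pi \o restr S)). Qed.

(** A relation over [K[S]] for the variable [i] modulo the kernel makes the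
    variable, scaled by the leading coefficient, integral over [K[S]].  The
    relation has positive degree in this variable because [S] is independent. *)
Lemma dependent_var_integral i : ~ indep ker (i |: S) ->
  exists g, restr S g != 0 /\ integral (pi (restr S g * 'X_i)).
Proof.
move=> /boolp.existsNP[f0 /boolp.not_implyP[fp /eqP fn0]].
set f := restr _ f0 in fp fn0.
pose F := poly_in i f.
have sF : map_poly (restr S) F = F.
  by rewrite /F -poly_in_restrU restr_id.
have F0 : F != 0 by rewrite poly_in_eq0.
have [k Fk] : exists k, size F = k.+2.
  case E: (size F) => [|[|k]]; [|exfalso|by exists k].
    by move/eqP: E; rewrite size_poly_eq0 (negPf F0).
  have fE : f = restr S F`_0.
    rewrite -coef_map sF -[LHS](poly_inK i) -/F.
    by rewrite [in LHS](size1_polyC (eq_leq E)) hornerC.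
  by move: fp fn0; rewrite fE => /pS ->; rewrite eqxx.
have [G [Gm sG GF]] := scaled_monic 'X_i Fk sF.
have cS : restr S (lead_coef F) = lead_coef F.
  by rewrite lead_coefE -coef_map sF.
exists (lead_coef F); rewrite cS lead_coef_eq0; split=> //.
exists G => //; rewrite map_poly_comp /= sG /root horner_map /= GF.
by rewrite (poly_inK i f) rmorphM fp mulr0 eqxx.
Qed.

(** Once [g], the product of the leading coefficients of relations for the
    variables outside [S], is inverted, the variables are integral over [K[S]]
    modulo the kernel, hence so is every polynomial. *)
Lemma eventually_integral : (forall i, i \notin S -> ~ indep ker (i |: S)) ->
  exists g, restr S g != 0 /\ forall r, exists j, integral (pi (restr S g ^+ j * r)).
Proof.
move=> maxS.
have /boolp.choice[h hP] i : exists g, i \notin S ->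
    restr S g != 0 /\ integral (pi (restr S g * 'X_i)).
  case: (boolP (i \in S)) => iS; first by exists 0.
  by have [g gP] := dependent_var_integral (maxS i iS); exists g.
pose g := \prod_(i | i \notin S) h i.
exists g; split.
  by rewrite rmorph_prod; apply/prodf_neq0 => i /hP[].
have int_pow j : integral (pi (restr S g ^+ j)).
  by rewrite -rmorphXn; apply: integral_restr.
elim/mpoly_ring_ind => [c|i|a b [j aj] [k bk]|a b [j aj] [k bk]].
- by exists 0%N; rewrite mul1r -(restrC S); apply: integral_restr.
- exists 1%N; rewrite expr1; case: (boolP (i \in S)) => iS.
    have -> : 'X_i = restr S 'X_i :> R by rewrite restrX iS.
    by rewrite -rmorphM; apply: integral_restr.
  have [_ hi] := hP i iS.
  pose h' := \prod_(j | (j \notin S) && (j != i)) h j.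
  have gE : g = h i * h' by rewrite /g (bigD1 i).
  have -> : restr S g * 'X_i = restr S h' * (restr S (h i) * 'X_i).
    by rewrite gE (rmorphM (restr S)) mulrAC mulrC.
  rewrite (rmorphM pi); apply: integral_mul => //; exact: integral_restr.
- exists (j + k)%N; rewrite mulrDr rmorphD exprD; apply: integral_add.
    by rewrite mulrAC mulrC rmorphM; apply: integral_mul.
  by rewrite -mulrA rmorphM; apply: integral_mul.
exists (j + k)%N; rewrite exprD mulrACA rmorphM; exact: integral_mul.
Qed.
End Integral.

Section PrimeStep.
Variables (K : fieldType) (N : nat) (p : prime_idealr {mpoly K[N]}).
Local Notation R := {mpoly K[N]}.

(** Put [a = 1 + x_s g], with [g] as in [eventually_integral], and suppose that
    [h = a r] modulo [p] for a nonzero [h] in [K[S]] free of [x_s].  An integral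
    equation for [g ^ j r], multiplied by a power of [a], shows that [a] divides
    [(g ^ j h) ^ k], because [p] meets [K[S]] only in [0].  As [g] is a unit
    modulo [a], also [a] divides [h ^ k], which contradicts the degrees in
    [x_s].  So a prime over [p] and [a] can avoid all such [h]. *)
Lemma indep_drop S s : indep (fun a => a \in p) S ->
    (forall i, i \notin S -> ~ indep (fun a => a \in p) (i |: S)) -> s \in S ->
  exists q : prime_idealr R, [/\ {subset p <= q}, exists2 a, a \in q & a \notin p
    & indep (fun a => a \in q) (S :\ s)].
Proof.
move=> pS maxS sS; have [quo [pi pi_eq0]] := ideal_is_kernel p.
have ker_indep A : indep (fun a => pi a = 0) A <-> indep (fun a => a \in p) A.
  split=> pA a; first by rewrite -pi_eq0 => /eqP/pA.
  by move=> /eqP; rewrite pi_eq0 => /pA.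
have [|i /maxS iS /ker_indep //|g0 [gn0 int_g]] := @eventually_integral _ _ _ pi S.
  exact/ker_indep.
set g := restr S g0 in gn0 int_g.
have gS : restr S g = g by rewrite restr_id.
pose a := 1 + 'X_s * g.
have aS : restr S a = a by rewrite rmorphD rmorph1 rmorphM /= gS restrX sS.
have size_a : (2 <= size (poly_in s a))%N.
  rewrite rmorphD rmorph1 rmorphM /= poly_inX eqxx.
  have szg : size ('X * poly_in s g) = (size (poly_in s g)).+1.
    by rewrite mulrC size_mulX // poly_in_eq0.
  by rewrite addrC size_polyDl szg ?size_poly1 ltnS lt0n size_poly_eq0 poly_in_eq0.
have a0 : a != 0.
  by apply: contraTneq size_a => ->; rewrite rmorph0 size_poly0.
have ap : a \notin p.
  by apply: contra a0; rewrite -aS => /pS ->.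
pose J (x : R) := exists r, x - a * r \in p.
pose T (x : R) := restr (S :\ s) x = x /\ x != 0.
have [|||||q [Jq qT]] := @prime_avoiding R J T.
- by exists 0; rewrite mulr0 subr0 idealr0.
- move=> x u v [r ru] [r' rv]; exists (x * r + r').
  rewrite mulrDr opprD addrACA mulrCA -mulrBr.
  by rewrite rpredD // idealMr.
- by split; [exact: rmorph1 | exact: oner_neq0].
- by move=> u v [uT u0] [vT v0]; split; [rewrite rmorphM /= uT vT | rewrite mulf_neq0].
- move=> h [r hr] [hS h0].
  have [j [P Pm]] := int_g r.
  rewrite map_poly_comp /=; set Q := map_poly (restr S) P => Qroot.
  have Qm : Q \is monic by apply: monic_map.
  have QS i : restr S Q`_i = Q`_i by rewrite coef_map /= restr_id.
  have [k Qk] : exists k, size Q = k.+1.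
    by exists (size Q).-1; rewrite prednK // size_poly_gt0 monic_neq0.
  pose y := g ^+ j * h.
  have hS' : restr S h = h by rewrite -hS restr_sub // subsetDl.
  (* The integral equation of g ^ j r, homogenized by powers of a, at y, which
     is congruent to a * (g ^ j r) modulo p. *)
  pose W := \sum_(i < k.+1) Q`_i * a ^+ (k - i) * y ^+ i.
  have WS : restr S W = W.
    rewrite rmorph_sum; apply: eq_bigr => i _.
    by rewrite !rmorphM !rmorphXn /= QS aS !rmorphM rmorphXn /= gS hS'.
  have Wp : W \in p.
    rewrite -pi_eq0.
    have piy : pi y = pi a * pi (g ^+ j * r).
      apply/eqP; rewrite -subr_eq0 -rmorphM -rmorphB pi_eq0.
      by rewrite /y mulrCA -mulrBr idealMr.
    move: Qroot piy; set z := pi (g ^+ j * r) => Qroot piy.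
    have -> : pi W = pi a ^+ k * (map_poly pi Q).[z].
      rewrite horner_coef size_map_poly_id0; last first.
        by rewrite (monicP Qm) rmorph1 oner_neq0.
      rewrite Qk big_distrr rmorph_sum; apply: eq_bigr => i _ /=.
      rewrite (coef_map pi) !rmorphM !rmorphXn /= piy exprMn.
      have -> : pi a ^+ k = pi a ^+ (k - i) * pi a ^+ i.
        by rewrite -exprD subnK // -ltnS.
      by rewrite !mulrA; congr (_ * _); rewrite -mulrA mulrC.
    by rewrite (rootP Qroot) mulr0.
  have W0 : W = 0 by rewrite -WS; apply: pS; rewrite WS.
  have [w yw] : exists w, y ^+ k = a * w.
    exists (- \sum_(i < k) Q`_i * a ^+ (k - i.+1) * y ^+ i).
    move: W0; rewrite /W big_ord_recr /= subnn mulr1.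
    have -> : Q`_k = 1 by have := monicP Qm; rewrite lead_coefE Qk.
    rewrite mul1r addrC => /eqP; rewrite addr_eq0 => /eqP ->.
    rewrite mulrN; congr (- _); rewrite big_distrr; apply: eq_bigr => i _ /=.
    by rewrite -[(k - i)%N](@subnSK i k) // exprS !mulrA [a * _]mulrC.
  (* modulo a, the inverse of g is - X_s *)
  have [w' hw'] : exists w', h ^+ k = a * w'.
    have [v gv] : exists v, 'X_s ^+ (j * k) * g ^+ (j * k) = (-1) ^+ (j * k) + a * v.
      elim: (j * k)%N => [|e [v IHe]]; first by exists 0; rewrite !expr0 mulr0 addr0 mulr1.
      exists ((-1) ^+ e + 'X_s * g * v); rewrite !exprS mulrACA IHe.
      rewrite !mulrDr mulrCA addrA; congr (_ + _).
      by rewrite -mulrDl /a addrA addNr add0r.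
    exists ((-1) ^+ (j * k) * ('X_s ^+ (j * k) * w - v * h ^+ k)).
    have yk : y ^+ k = g ^+ (j * k) * h ^+ k by rewrite exprMn exprM.
    rewrite mulrCA mulrBr [a * ('X_s ^+ _ * w)]mulrCA -yw yk !mulrA gv.
    by rewrite mulrDl addrK mulrA -exprMn mulrNN mulr1 expr1n mul1r.
  have hkE : poly_in s (h ^+ k) = (h ^+ k)%:P.
    by rewrite -hS -rmorphXn poly_in_restr // setD11.
  have hk : h ^+ k != 0 by rewrite expf_neq0.
  have w'0 : poly_in s w' != 0.
    by rewrite poly_in_eq0; apply: contraNneq hk => w'0; rewrite hw' w'0 mulr0.
  have size_aw : (1 < size (poly_in s a * poly_in s w')%R)%N.
    exact: size_mul_gt1.
  have awE : poly_in s a * poly_in s w' = (h ^+ k)%:P.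
    by rewrite -hkE hw' (rmorphM (poly_in s)).
  by move: size_aw; rewrite awE ltnNge size_polyC_leq1.
exists q; split.
- by move=> x xp; apply: Jq; exists 0; rewrite mulr0 subr0.
- by exists a => //; apply: Jq; exists 1; rewrite mulr1 subrr idealr0.
move=> x xq; apply/eqP; apply: contraPT xq => x0 xq.
by apply: (qT _ xq); split=> //; apply: restr_id.
Qed.
End PrimeStep.

Lemma prime_chain_above (K : fieldType) N m (p : prime_idealr {mpoly K[N]}) S :
    indep (fun a => a \in p) S -> (m <= #|S|)%N ->
  exists P : nat -> prime_idealr {mpoly K[N]}, P 0%N = p /\
    forall k, (k < m)%N -> {subset P k <= P k.+1} /\ exists2 a, a \in P k.+1 & a \notin P k.
Proof.
elim: m p S => [|m IHm] p S pS mS; first by exists (fun=> p).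
have [S' maxS' sSS'] : {S' | maxset
    (fun A => boolp.asbool (indep (fun a => a \in p) A)) S' & S \subset S'}.
  by apply: maxset_exists; apply/boolp.asboolP.
have /maxsetP[/boolp.asboolP pS' S'max] := maxS'.
have mS' : (m < #|S'|)%N := leq_trans mS (subset_leq_card sSS').
have /card_gt0P[s sS'] : (0 < #|S'|)%N by apply: leq_ltn_trans mS'.
have [|q [pq pq' qS]] := indep_drop pS' _ sS'.
  move=> i iS' /boolp.asboolP/S'max/(_ (subsetU1 _ _)) iE.
  by move: iS'; rewrite -iE setU11.
have [|P [P0 Pm]] := IHm q _ qS.
  by move: mS'; rewrite (cardsD1 s) sS'.
exists (fun i => if i is i'.+1 then P i' else p); split=> // -[_|k /Pm //].
by rewrite P0.
Qed.

(** * Dimension and independent sets of variables *)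

Section KrullDim.
Variables (K : fieldType) (N : nat).
Local Notation R := {mpoly K[N]}.
Variable V : lmodType R.
Let ann (a : R) := forall v : V, a *: v = 0.

Lemma prime_chain_indep m (p : 'I_m.+1 -> prime_idealr R) :
  prime_chain V p -> exists2 S, indep ann S & #|S| = m.
Proof.
move=> [p_ann p_lt]; pose P k := p (inord k).
have PS k (km : (k < m)%N) :
    {subset P k <= P k.+1} /\ exists2 a, a \in P k.+1 & a \notin P k.
  by apply: p_lt; rewrite !inordK ?ltnS // ltnW.
have /boolp.choice[a aP] (k : 'I_m) : exists a, a \in P k.+1 /\ a \notin P k.
  by have [_ [a aP aP']] := PS k (ltn_ord k); exists a.
have free f : f \mPo [tuple a i | i < m] \in P 0%N -> f = 0.
  apply: chain_alg_indep => [k /PS[] //|k|k]; rewrite tnth_mktuple; by case: (aP k).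
apply: boolp.contrapT => noS.
have [] := @alg_dep_of_dependent_subsets K N
  (fun a => a \in P 0%N) _ _ m [tuple a i | i < m].
- exact: idealr0.
- by move=> r u v uP vP; rewrite rpredD // idealMr.
- move=> S Sm PS0; apply: noS; exists S => //.
  by apply: indep_sub PS0 => // b bann; apply: p_ann.
by move=> f [f0 /free f0']; rewrite f0' eqxx in f0.
Qed.

(** The first prime comes from avoiding the nonzero elements of [K[S]]; each
    further one costs one variable of [S]. *)
Lemma indep_prime_chain S : indep ann S ->
  exists p : 'I_(#|S|.+1) -> prime_idealr R, prime_chain V p.
Proof.
move=> annS; pose T (x : R) := restr S x = x /\ x != 0.
have [|||||p0 [p0ann p0T]] := @prime_avoiding R ann T.
- by move=> v; rewrite scale0r.
- by move=> a u v Iu Iv w; rewrite scalerDl -scalerA Iu Iv scaler0 addr0.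
- by split; [exact: rmorph1 | exact: oner_neq0].
- by move=> u v [uT u0] [vT v0]; split; [rewrite rmorphM /= uT vT | rewrite mulf_neq0].
- by move=> u u_ann [uS u0]; move/eqP: u0; apply; rewrite -uS; apply: annS; rewrite uS.
have p0S : indep (fun a => a \in p0) S.
  move=> a ap; apply/eqP; apply: contraPT ap => a0 ap.
  by apply: (p0T _ ap); split; rewrite ?restr_id.
have [P [P0 PS]] := prime_chain_above p0S (leqnn _).
have P_sub k d : (k + d <= #|S|)%N -> {subset P k <= P (k + d)%N}.
  elim: d => [|d IHd]; first by rewrite addn0 => _ x.
  rewrite addnS => kd x /(IHd (ltnW kd)).
  by have [sub _] := PS _ kd; apply: sub.
exists (fun i => P i); split=> [i a a_ann|i j ij].
  have := P_sub 0%N i; rewrite add0n -ltnS ltn_ord P0 => /(_ isT); apply.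
  exact: p0ann.
have jS : (j <= #|S|)%N by rewrite -ltnS.
have [sub [a aP aP']] := PS i (leq_trans ij jS).
have sub' : {subset P i.+1 <= P j}.
  by move: (P_sub i.+1 (j - i.+1)%N); rewrite subnKC // => /(_ jS).
by split=> [x /sub/sub' //|]; exists a; first exact: sub'.
Qed.

Lemma krull_dim_max_indep d :
    (exists2 S, indep ann S & #|S| = d) -> (forall S, indep ann S -> (#|S| <= d)%N) ->
  krull_dim_is V d%:Z.
Proof.
move=> [S annS <-] maxS; exists #|S|.+1; split; first by rewrite -addn1 PoszD addrK.
  exact: indep_prime_chain.
by move=> [|l] p //= /prime_chain_indep[S' /maxS] + <-.
Qed.

Lemma krull_dim_no_indep : (forall S, ~ indep ann S) -> krull_dim_is V (-1).
Proof.
move=> noS; exists 0%N; split; first by rewrite sub0r.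
  have p : 'I_0 -> prime_idealr R by case.
  by exists p; split=> [[]|[]].
by move=> [|l] p //= /prime_chain_indep[S /noS].
Qed.
End KrullDim.

(** * Maximal weights of words closed under deletion *)

(** A word of length [n] is given by its marked positions [mk] and the weights
    [w] of its letters; [L] is the set of words under consideration. *)
Section Words.
Local Open Scope nat_scope.
Variables (L : forall n, ('I_n -> bool) -> ('I_n -> nat) -> Prop) (c D : nat).
Arguments L : clear implicits.
Hypothesis L_del : forall n mk w (j : 'I_n.+1), ~~ mk j ->
  L n.+1 mk w -> L n (mk \o lift j) (w \o lift j).
Hypothesis L_mk : forall n mk w, L n mk w -> \sum_(j < n) mk j <= D.
Hypothesis L_wt : forall n mk w j, L n mk w -> w j <= c.

(** Only unmarked letters are counted, as the others cannot be deleted. *)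
Let heavy a n (mk : 'I_n -> bool) (w : 'I_n -> nat) :=
  \sum_(j < n) (~~ mk j && (a <= w j)).

Lemma sum_lift n (j : 'I_n.+1) (F : 'I_n.+1 -> nat) :
  \sum_i F i = F j + \sum_i F (lift j i).
Proof. exact: bigD1_ord. Qed.

Lemma unmarked_light a n mk w : L n mk w -> heavy a mk w + D < n ->
  exists j : 'I_n, ~~ mk j && (w j < a).
Proof.
move=> Lw hn; apply/existsP; apply: contraTT hn => /existsPn light.
rewrite -leqNgt -[n in n <= _]card_ord -sum1_card.
apply: (leq_trans _ (leq_add (leqnn _) (L_mk Lw))).
rewrite /heavy -big_split /=; apply: leq_sum => j _.
by have := light j; case: (mk j) (ltnP (w j) a) => [] [].
Qed.

(** Unmarked letters of weight below [a] are deleted first; once none is left,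
    any unmarked letter may go, as the [n - D] unmarked letters that must
    remain are all heavy. *)
Lemma trim a n n1 mk w : D <= n -> n <= n1 -> L n1 mk w ->
  n - D <= heavy a mk w ->
  exists mk' w', L n mk' w' /\ n - D <= heavy a mk' w'.
Proof.
move=> Dn /subnK; move: (n1 - n) => d dn; move: mk w; rewrite -dn {n1 dn}.
elim: d => [|d IHd]; first by move=> mk w; exists mk, w.
rewrite addSn => mk w Lw hw.
case: (boolP [exists j, ~~ mk j && (w j < a)]) => [/existsP[j /andP[mkj wj]]|].
  apply: (IHd _ _ (L_del mkj Lw)).
  move: hw; rewrite {1}/heavy (sum_lift j) mkj (leqNgt a) wj add0n.
  by rewrite /heavy /=.
move=> /existsPn light.
have h1 : (d + n).+1 <= heavy a mk w + D.
  rewrite leqNgt; apply/negP => /(unmarked_light Lw)[j lj].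
  by have := light j; rewrite lj.
have [j mkj] : exists j, ~~ mk j.
  apply/existsP; apply: contraTT (L_mk Lw) => /existsPn allmk.
  rewrite -ltnNge (leq_trans (_ : D < d + n + 1)) //.
    by rewrite addn1 ltnS (leq_trans Dn) ?leq_addl.
  rewrite addn1 -[X in X <= _]card_ord -sum1_card.
  by apply: leq_sum => j _; have := allmk j; rewrite negbK => ->.
apply: (IHd _ _ (L_del mkj Lw)).
have : heavy a mk w <= 1 + heavy a (mk \o lift j) (w \o lift j).
  by rewrite {1}/heavy (sum_lift j) leq_add2r leq_b1.
move: h1; rewrite leq_subLR; move: (heavy a mk w) (heavy a (mk \o _) _) => h h'; lia.
Qed.

(** The integer [A * D] on both sides keeps the equations in the natural
    numbers: the maximal weight at length [n] is at least [A * (n - D)]. *)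
Lemma words_linear :
  (exists n0, forall n, n0 <= n -> forall mk w, ~ L n mk w) \/
  (exists A v n0, forall n, n0 <= n ->
    (exists mk w, L n mk w /\ \sum_j w j + A * D = A * n + v) /\
    (forall mk w, L n mk w -> \sum_j w j + A * D <= A * n + v)).
Proof.
pose unb a := forall h, exists n mk w, L n mk w /\ h <= heavy a mk w.
have bounded a : ~ unb a ->
    exists h, forall n mk w, L n mk w -> heavy a mk w < h.
  move=> /boolp.existsNP[h hP]; exists h => n mk w Lw.
  by rewrite ltnNge; apply/negP => hh; apply: hP; exists n, mk, w.
case: (boolp.pselect (unb 0)) => [unb0|/bounded[h hP]]; last first.
  left; exists (h + D).+1 => n hn mk w Lw.
  have [|j] := unmarked_light (a := 0) Lw; last by rewrite ltn0 andbF.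
  by apply: leq_trans hn; rewrite ltnS leq_add2r ltnW // hP.
right.
have [A [unbA maxA]] : exists A, unb A /\ forall a, unb a -> a <= A.
  have ex : exists a, boolp.asbool (unb a) by exists 0; apply/boolp.asboolP.
  have ub a : boolp.asbool (unb a) -> a <= c.
    move=> /boolp.asboolP/(_ 1)[n [mk [w [Lw]]]].
    rewrite lt0n sum_nat_eq0 => /forallPn[j].
    by rewrite /= eqb0 negbK => /andP[_ /leq_trans]; apply; apply: L_wt Lw.
  have [A /boolp.asboolP unbA maxA] := ex_maxnP ex ub.
  by exists A; split=> // a /boolp.asboolP/maxA.
have [h hP] : exists h, forall n mk w, L n mk w -> heavy A.+1 mk w < h.
  by apply: bounded => /maxA; rewrite ltnn.
pose n1 := h + D.
have drop n mk w : n1 <= n -> L n.+1 mk w ->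
    exists mk' w', L n mk' w' /\ \sum_j w j <= \sum_j w' j + A.
  move=> n1n Lw; have [|j /andP[mkj wj]] := unmarked_light (a := A.+1) Lw.
    by rewrite ltnS (leq_trans _ n1n) // leq_add2r ltnW // hP.
  exists (mk \o lift j), (w \o lift j); split; first exact: L_del.
  by rewrite (sum_lift j) addnC leq_add2l.
have lower n : D <= n -> exists mk w, L n mk w /\ A * n <= \sum_j w j + A * D.
  move=> Dn; have [n' [mk [w [Lw hw]]]] := unbA n.
  have nn' : n <= n'.
    apply: leq_trans hw _; rewrite -[n' in _ <= n']card_ord -sum1_card.
    by apply: leq_sum => j _; apply: leq_b1.
  have [mk' [w' [Lw' hw']]] := trim Dn nn' Lw (leq_trans (leq_subr _ _) hw).
  exists mk', w'; split=> //; rewrite addnC -leq_subLR -mulnBr.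
  apply: leq_trans (leq_mul (leqnn A) hw') _.
  rewrite /heavy big_distrr /=; apply: leq_sum => j _.
  by case: (mk' j) (leqP A (w' j)) => [] [] //=; rewrite ?muln0 ?muln1.
(* The largest v in P is the limit of the nonincreasing, nonnegative sequence
   formed by the maximal weight at length n plus A * D - A * n. *)
pose P v := forall n, n1 <= n ->
  exists mk w, L n mk w /\ A * n + v <= \sum_j w j + A * D.
have [v [Pv maxv]] : exists v, P v /\ forall u, P u -> u <= v.
  have ex : exists v, boolp.asbool (P v).
    exists 0; apply/boolp.asboolP => n n1n.
    have [|mk [w [Lw hw]]] := lower n; first by rewrite (leq_trans (leq_addl _ _) n1n).
    by exists mk, w; rewrite addn0.
  have ub v : boolp.asbool (P v) -> v <= c * n1 + A * D.
    move=> /boolp.asboolP/(_ n1 (leqnn _))[mk [w [Lw hw]]].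
    apply: leq_trans (leq_trans (leq_addl _ _) hw) _; rewrite leq_add2r.
    apply: (@leq_trans (\sum_(j < n1) c)); last by rewrite sum_nat_const card_ord mulnC.
    by apply: leq_sum => j _; apply: L_wt Lw.
  have [v /boolp.asboolP Pv maxv] := ex_maxnP ex ub.
  by exists v; split=> // u /boolp.asboolP/maxv.
have [n2 n2P] : exists n2, n1 <= n2 /\ forall mk w, L n2 mk w ->
    \sum_j w j + A * D <= A * n2 + v.
  have /boolp.existsNP[n2] : ~ P v.+1 by move=> /maxv; rewrite ltnn.
  move=> /boolp.not_implyP[n12 nP]; exists n2; split=> // mk w Lw.
  by rewrite leqNgt; apply/negP => hw; apply: nP; exists mk, w; rewrite addnS.
have upper n : n2 <= n -> forall mk w, L n mk w ->
    \sum_j w j + A * D <= A * n + v.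
  case: n2P => n12 n2P; elim: n => [|n IHn].
    by rewrite leqn0 => /eqP n20; move: n2P; rewrite n20.
  rewrite leq_eqVlt => /orP[/eqP <- //|n2n] mk w Lw.
  have [mk' [w' [Lw' hw]]] := drop _ _ _ (leq_trans n12 n2n) Lw.
  have := IHn n2n _ _ Lw'; rewrite mulnS; lia.
exists A, v, n2 => n n2n; split; last exact: upper.
have [mk [w [Lw hw]]] := Pv n (leq_trans n2P.1 n2n).
exists mk, w; split=> //; apply/eqP; rewrite eqn_leq hw andbT.
exact: (upper n n2n mk w Lw).
Qed.
End Words.

(** * Deleting a column of variables *)

Section Deletion.
Variables (K : fieldType) (c : nat) (C : OI_or_FI) (n : nat) (j : 'I_n.+1).

Lemma is_mor_lift : is_mor C [ffun i : 'I_n => lift j i].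
Proof.
case: C => /=; last by apply/injectiveP => i k; rewrite !ffunE => /lift_inj.
apply/forallP => i; apply/forallP => k; apply/implyP => ik; rewrite !ffunE /=.
by rewrite ltnNge leq_bump2 -ltnNge.
Qed.

Lemma is_mor_unlift d (delta : {ffun 'I_d -> 'I_n.+1}) (e : 'I_d -> 'I_n) :
  is_mor C delta -> (forall i, delta i = lift j (e i)) -> is_mor C [ffun i => e i].
Proof.
move=> + eP; case: C => /= [|/injectiveP delta_inj].
  move=> /forallP delta_mono; apply/forallP => i; apply/forallP => k.
  apply/implyP => ik; rewrite !ffunE.
  move/(_ i)/forallP/(_ k)/implyP/(_ ik): delta_mono.
  by rewrite !eP /= ltnNge leq_bump2 -ltnNge.
by apply/injectiveP => i k; rewrite !ffunE => eik; apply: delta_inj; rewrite !eP eik.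
Qed.

Definition mor_lift : mor C n n.+1 := exist (@is_mor C n n.+1) _ is_mor_lift.

Lemma mor_lift_factor d (delta : mor C d n.+1) :
    (forall i, val delta i != j) ->
  exists delta' : mor C d n, delta = mor_comp mor_lift delta'.
Proof.
move=> dj; have /boolp.choice[e eP] i : exists k, val delta i = lift j k.
  case: (unliftP j (val delta i)) => [k ->|dij]; first by exists k.
  by have := dj i; rewrite dij eqxx.
have e_mor : is_mor C [ffun i => e i].
  exact: is_mor_unlift (valP delta) eP.
exists (exist (@is_mor C d n) _ e_mor); apply/val_inj/ffunP => i.
by rewrite /= !ffunE eP.
Qed.

(** Killing the variables of column [j] gives a left inverse. *)
Lemma Pmap_lift_inj : injective (Pmap (mor_lift) : Pn K c n -> Pn K c n.+1).
Proof.
pose t : (c * n.+1).-tuple {mpoly K[c * n]} :=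
  [tuple mxvec (\matrix_(i < c, k < n.+1)
     (if unlift j k is Some k' then xvar K i k' else 0 : {mpoly K[c * n]})) 0 l
  | l < c * n.+1].
apply: (can_inj (g := comp_mpoly t)) => a.
have /= := @mpoly_rmorph_ext K (c * n) _ (comp_mpoly t \o Pmap mor_lift) idfun.
apply=> [b|l] /=; first by rewrite /Pmap !comp_mpolyC.
case/mxvec_indexP: l => i k.
have /= -> := PmapX K mor_lift i k; rewrite ffunE.
by rewrite /xvar comp_mpolyXU -tnth_nth tnth_mktuple mxvecE mxE liftK.
Qed.

Definition delete_column (S : {set 'I_(c * n.+1)}) : {set 'I_(c * n)} :=
  [set l | mxvec (\matrix_(i < c, k < n) (mxvec_index i (lift j k) \in S)) 0 l].

Lemma in_delete_column S i k :
  (mxvec_index i k \in delete_column S) = (mxvec_index i (lift j k) \in S).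
Proof. by rewrite inE mxvecE mxE. Qed.

Lemma Pmap_lift_restr S (a : Pn K c n) :
  Pmap mor_lift (restr (delete_column S) a) = restr S (Pmap mor_lift a).
Proof.
have /= := @mpoly_rmorph_ext K (c * n) _ (Pmap mor_lift \o restr (delete_column S))
  (restr S \o Pmap mor_lift).
apply=> [b|l] /=; first by rewrite /Pmap restrC !comp_mpolyC restrC.
case/mxvec_indexP: l => i k; rewrite restrX in_delete_column.
have /= X := PmapX K mor_lift i k; rewrite ffunE in X.
rewrite X restrX; case: ifP => // _.
exact: rmorph0.
Qed.

End Deletion.

(** * Words attached to a module *)

Section Modules.
Variables (K : fieldType) (c : nat) (C : OI_or_FI) (M : Pmodule K c C).

Definition generates (G : seq {n : nat & M n}) : Prop :=
  forall N : (forall n, {pred M n}), submodule N ->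
    (forall g, g \in G -> tagged g \in N (tag g)) ->
    forall n (q : M n), q \in N n.

Definition kills n (q : M n) (a : Pn K c n) : Prop := a *: q = 0.

(** The elements all of whose images in [M_n] are killed by [a] form a
    submodule; quantifying over the images is what makes it functorial, as [a]
    itself need not come from a smaller polynomial ring. *)
Lemma generators_kill (G : seq {n : nat & M n}) n (a : Pn K c n) :
    generates G ->
    (forall g, g \in G ->
      forall delta : mor C (tag g) n, kills (act M delta (tagged g)) a) ->
  forall q : M n, kills q a.
Proof.
move=> genG Ga q.
pose Nn m (x : M m) := forall (e : mor C m n), kills (act M e x) a.
pose N m : {pred M m} := fun x => boolp.asbool (Nn m x).
have : q \in N n.
  apply: genG => [|g gG]; last by apply/boolp.asboolP => e; apply: Ga.
  split=> [m|m m' f x /boolp.asboolP xN]; last first.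
    by apply/boolp.asboolP => e; rewrite -act_comp; apply: xN.
  split=> [|b x y /boolp.asboolP xN /boolp.asboolP yN]; apply/boolp.asboolP => e.
    by rewrite raddf0 /kills scaler0.
  rewrite /kills linearP /= scalerDr scalerA mulrC -scalerA xN yN.
  by rewrite scaler0 addr0.
by move=> /boolp.asboolP/(_ (mor_id C n)); rewrite act_id.
Qed.

(** If each of the finitely many elements [act M delta g] were killed by some
    nonzero element of [K[S]], the product of these would be a nonzero element of
    [K[S]] killing [M_n]. *)
Lemma indep_ann_generator (G : seq {n : nat & M n}) n (S : {set 'I_(c * n)}) :
    generates G ->
    indep (fun a : Pn K c n => forall q : M n, a *: q = 0) S ->
  exists g (delta : mor C (tag g) n), g \in G /\ indep (kills (act M delta (tagged g))) S.
Proof.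
move=> genG annS; apply: boolp.contrapT => noind.
pose images (g : {n : nat & M n}) :=
  [seq act M d (tagged g) | d <- enum {: mor C (tag g) n}].
pose L : seq (M n) := flatten [seq images g | g <- G].
have [a [a0 aL]] : exists a, restr S a != 0 /\ forall q, q \in L -> kills q (restr S a).
  have : forall q, q \in L -> ~ indep (kills q) S.
    move=> q /flattenP[_ /mapP[g gG ->] /mapP[d _ ->]] ind.
    by apply: noind; exists g, d.
  elim: L => [|x L IHL] Lind.
    by exists 1; split=> //; rewrite rmorph1 oner_neq0.
  have [|a [a0 aL]] := IHL; first by move=> q qL; apply: Lind; rewrite inE qL orbT.
  have /boolp.existsNP[b /boolp.not_implyP[bx /eqP b0]] := Lind x (mem_head _ _).
  exists (a * b); rewrite (rmorphM (restr S)) mulf_neq0 //; split=> // q.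
  rewrite inE => /predU1P[->|/aL qa]; first by rewrite /kills -scalerA bx scaler0.
  by rewrite /kills mulrC -scalerA qa scaler0.
move/eqP: a0; apply; apply: annS => q; apply: (generators_kill genG) => g gG d.
apply: aL; apply/flattenP; exists (images g); first exact: map_f gG.
by apply: map_f; rewrite mem_enum.
Qed.

(** The annihilators of the images of [q] are carried into one another by
    [Pmap], which here is injective and matches the two polynomial subrings. *)
Lemma indep_delete_column n (j : 'I_n.+1) d (q : M d) (delta : mor C d n) S :
    indep (kills (act M (mor_comp (mor_lift C j) delta) q)) S ->
  indep (kills (act M delta q)) (delete_column j S).
Proof.
move=> indS a a_kills; apply: (@Pmap_lift_inj K c C n j).
rewrite (rmorph0 (Pmap (mor_lift C j))) Pmap_lift_restr; apply: indS.
rewrite /kills act_comp -Pmap_lift_restr.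
have /= <- := linearZ_LR (act M (mor_lift C j))
  (restr (delete_column j S) a) (act M delta q).
by rewrite a_kills raddf0.
Qed.

(** The words attached to [M]: one letter per column of variables, marked when
    the column is in the image of [delta], and weighing the number of variables
    of [S] in it. *)
Definition column_word (G : seq {n : nat & M n}) n (mk : 'I_n -> bool) (w : 'I_n -> nat) :=
  exists g (delta : mor C (tag g) n) (S : {set 'I_(c * n)}),
  [/\ g \in G, indep (kills (act M delta (tagged g))) S,
      forall k, mk k = (k \in codom (val delta))
    & forall k, w k = #|[set i | mxvec_index i k \in S]|].

Lemma card_columns n (S : {set 'I_(c * n)}) :
  (\sum_(k < n) #|[set i | mxvec_index i k \in S]| = #|S|)%N.
Proof.
rewrite -[RHS]sum1_card [RHS]big_mkcond /= (reindex _ (curry_mxvec_bij c n)) /=.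
rewrite [RHS](eq_bigr (fun p => if mxvec_index p.1 p.2 \in S then 1 else 0)%N);
  last by case.
rewrite -(pair_bigA _ (fun i k => if mxvec_index i k \in S then 1 else 0)%N) /=.
rewrite exchange_big; apply: eq_bigr => k _.
by rewrite -big_mkcond sum1dep_card.
Qed.

Lemma column_word_del G n mk w (j : 'I_n.+1) : ~~ mk j ->
  column_word G mk w -> column_word G (mk \o lift j) (w \o lift j).
Proof.
move=> mkj [g [delta [S [gG indS mkE wE]]]].
have [i|delta' dE] := @mor_lift_factor C n j _ delta.
  by apply: contraNneq mkj => <-; rewrite mkE codom_f.
subst delta; exists g, delta', (delete_column j S); split=> //.
- exact: indep_delete_column.
- move=> k /=; rewrite mkE; apply/codomP/codomP => -[i].
    by rewrite /= !ffunE => /lift_inj; exists i.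
  by move=> ->; exists i; rewrite /= !ffunE.
move=> k /=; rewrite wE; apply: eq_card => i.
by rewrite [LHS]in_set [RHS]in_set in_delete_column.
Qed.
End Modules.

Theorem theorem5p16 (K : fieldType) (c : nat) (hc : (1 <= c)%N)
    (C : OI_or_FI) (M : Pmodule K c C) (hM : finitely_generated M) :
  exists A B : int, exists n0 : nat, forall n : nat, (n0 <= n)%N ->
    krull_dim_is (M n) (A * n%:Z + B)%R.
Proof.
have [G genG] := hM.
pose D := (\max_(g <- G) tag g)%N.
pose ind n S := indep (fun a : Pn K c n => forall q : M n, a *: q = 0) S.
have word_ind n (mk : 'I_n -> bool) w : column_word G mk w ->
    exists2 S, ind n S & (#|S| = \sum_k w k)%N.
  move=> [g [delta [S [gG indS _ wE]]]]; exists S.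
    by apply: indep_sub indS => // a; apply.
  by rewrite -card_columns; apply: eq_bigr => k _; rewrite wE.
have ind_word n S : ind n S -> exists mk w, @column_word K c C M G n mk w /\
    (\sum_k w k = #|S|)%N.
  move=> /(indep_ann_generator genG)[g [delta [gG indS]]].
  exists (fun k => k \in codom (val delta)), (fun k => #|[set i | mxvec_index i k \in S]|).
  by split; [exists g, delta, S | apply: card_columns].
have [|n mk w|n mk w k|[n0 none]|[A [v [n0 linear]]]] :=
  @words_linear (fun n mk w => @column_word K c C M G n mk w) c D.
- by move=> n mk w j; apply: column_word_del.
- move=> [g [delta [S [gG _ mkE _]]]].
  apply: (@leq_trans (tag g)); last by apply: leq_bigmax_seq.
  under eq_bigr do rewrite mkE; rewrite -big_mkcond sum1_card.
  by apply: leq_trans (card_size _) _; rewrite size_codom card_ord.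
- move=> [g [delta [S [_ _ _ ->]]]].
  by rewrite -[X in (_ <= X)%N](card_ord c) max_card.
- exists 0, (-1), n0 => n n0n; rewrite mul0r add0r.
  apply: krull_dim_no_indep => S /ind_word[mk [w [Lw _]]].
  exact: none n n0n _ _ Lw.
exists A%:Z, (v%:Z - (A * D)%N%:Z), n0 => n n0n.
have [[mk [w [Lw wE]]] wmax] := linear n n0n.
have [S indS SE] := word_ind _ _ _ Lw.
have -> : A%:Z * n%:Z + (v%:Z - (A * D)%N%:Z) = #|S|%:Z.
  by rewrite -SE in wE; move: wE; move: #|S| => s; lia.
apply: krull_dim_max_indep => [|S' /ind_word[mk' [w' [Lw' <-]]]]; first by exists S.
by rewrite SE -(leq_add2r (A * D)) wE; apply: wmax Lw'.
Qed.
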